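(* For each integer $n\ge 1$ there exists a Steiner triple system $M$ of order $6n+1$ such that $\mathcal{D}(M,3)\ge 5n+1$. Consequently $\mathcal{D}(6n+1,3)\ge 5n+1$.
   Context: A Steiner triple system of order $v$, $\mathrm{STS}(v)$, is a pair $(V,\mathcal{B})$ where $|V|=v$ and $\mathcal{B}$ is a collection of $3$-subsets of $V$ (blocks) such that every $2$-subset of $V$ lies in exactly one block. A $3$-coloring is a map $\phi:V\to C$ with $|C|=3$ such that no block is monochromatic. A defining set of a $3$-coloring $\phi$ is a subset $S\subseteq V$ together with the colors $\phi|_S$ such that $\phi$ is the unique $3$-coloring of $(V,\mathcal{B})$ extending $\phi|_S$. A defining set is minimal if no proper subset of it (with the restricted colors) is a defining set of the same coloring. For an $\mathrm{STS}(v)$ $D$ admitting a $3$-coloring, $\mathcal{D}(D,3)$ is the largest cardinality of a minimal defining set of a $3$-coloring of $D$ (maximum over all $3$-colorings and all their minimal defining sets), and $\mathcal{D}(v,3)=\max\{\mathcal{D}(D,3)\}$ over all $3$-chromatic Steiner triple systems $D$ of order $v$. *)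

(* Defs.v *)
From HB Require Import structures.
From mathcomp Require Import all_boot.
Set Implicit Arguments.
Unset Strict Implicit.
Unset Printing Implicit Defensive.

Section Triples.
Variable V : finType.
Implicit Types (B : {set {set V}}) (S : {set V}).

Definition steiner_triple_system B : bool :=
  [forall b in B, #|b| == 3] &&
  [forall p : {set V}, (#|p| == 2) ==> (#|[set b in B | p \subset b]| == 1)].

Definition monochromatic k (f : {ffun V -> 'I_k}) (b : {set V}) : bool :=
  [exists c : 'I_k, [forall x in b, f x == c]].

Definition coloring k B (f : {ffun V -> 'I_k}) : bool :=
  [forall b in B, ~~ monochromatic f b].

Definition colorable k B : bool :=
  [exists f : {ffun V -> 'I_k}, coloring B f].

(* The chromatic number of B is k. *)
Definition chromatic k B : bool :=
  colorable k B && [forall j : 'I_k, ~~ colorable j B].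

Definition extends_on k S (f g : {ffun V -> 'I_k}) : bool :=
  [forall x in S, g x == f x].

Definition defining_set k B (f : {ffun V -> 'I_k}) S : bool :=
  coloring B f &&
  [forall g : {ffun V -> 'I_k}, coloring B g && extends_on S f g ==> (g == f)].

Definition minimal_defining_set k B (f : {ffun V -> 'I_k}) S : bool :=
  defining_set B f S &&
  [forall T : {set V}, (T \proper S) ==> ~~ defining_set B f T].

(* D(B, k), meaningful when B is k-colorable; the empty maximum is 0. *)
Definition max_mds B k : nat :=
  \max_(f : {ffun V -> 'I_k})
    \max_(S : {set V} | minimal_defining_set B f S) #|S|.

End Triples.

(* D(v, k).  Everything above is invariant under renaming points, so it is
   enough to let the systems of order v range over those with point set 'I_v. *)
Definition max_mds_order (v k : nat) : nat :=
  \max_(B : {set {set 'I_v}} | steiner_triple_system B && chromatic k B)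
    max_mds B k.

(* Main.v *)
Require Import Defs.
From mathcomp Require Import all_boot.
From mathcomp Require Import ssralg ssrnum ssrint zify.

(** A Steiner triple system is the same as a totally symmetric idempotent
    quasigroup [t], the blocks being the sets [{x, y, t x y}].  Take Skolem's
    system of order [6n+1] on three levels of [2n] points and a point at
    infinity, colour each level by its own colour (0, 1, 2) and infinity by 1.
    Omit the [n] points of the upper half of level 0: colour 1 is excluded
    for them by the block through infinity, and colour 2 by a block with two
    points on level 2.  Each of the other [5n+1] points can be recoloured
    alone (infinity and level 2 to colour 0, level 1 to colour 2, the lower
    half of level 0 to colour 1), so these points form a minimal defining
    set. *)

Set Implicit Arguments.
Unset Strict Implicit.
Unset Printing Implicit Defensive.

(** * Steiner quasigroups *)

Definition steiner_quasigroup (V : Type) (t : V -> V -> V) : Prop :=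
  [/\ forall x, t x x = x, commutative t & forall x y, t x (t x y) = y].

Section Quasigroup.
Variables (V : finType) (t : V -> V -> V).
Hypothesis tP : steiner_quasigroup t.

Definition blk x y : {set V} := [set x; y; t x y].

Definition blocks : {set {set V}} :=
  [set blk p.1 p.2 | p : V * V & p.1 != p.2].

Lemma sq_neql x y : x != y -> t x y != x.
Proof.
case: tP => tid _ tK; apply: contraNneq => h.
by rewrite -(tK x y) h tid.
Qed.

Lemma sq_neqr x y : x != y -> t x y != y.
Proof. by case: (tP) => _ tC _; rewrite tC eq_sym; exact: sq_neql. Qed.

Lemma blkC x y : blk x y = blk y x.
Proof. by case: tP => _ tC _; rewrite /blk tC [[set x; y]]setUC. Qed.

Lemma blk_third x y : blk x (t x y) = blk x y.
Proof. by case: tP => _ _ tK; rewrite /blk tK -!setUA [[set t x y; y]]setUC. Qed.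

(** Any two points of a block generate it, which makes the block through a pair unique. *)
Lemma blk_eq u v x y : u != v -> x != y ->
  x \in blk u v -> y \in blk u v -> blk x y = blk u v.
Proof.
case: (tP) => tid tC tK uv xy; rewrite !inE -!orbA.
have third_r a b : blk (t a b) b = blk a b by rewrite tC blkC blk_third blkC.
case/or3P => /eqP ?; case/or3P => /eqP ?; subst x y; rewrite ?eqxx // in xy *.
- exact: blk_third.
- exact: blkC.
- by rewrite blkC third_r.
- by rewrite blkC blk_third.
Qed.

Lemma mem_blocks x y : x != y -> blk x y \in blocks.
Proof. by move=> xy; apply/imsetP; exists (x, y); rewrite ?inE. Qed.

Lemma steiner_blocks : steiner_triple_system blocks.
Proof.
apply/andP; split.
  apply/forall_inP => b /imsetP[[x y]]; rewrite inE /= => xy ->.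
  by rewrite /blk setUC cardsU1 cards2 !inE negb_or sq_neql // sq_neqr // xy.
apply/forallP => p; apply/implyP => /cards2P[x [y [xy ->]]].
apply/cards1P; exists (blk x y); apply/setP => b; rewrite !inE subUset !sub1set.
apply/idP/eqP => [/and3P[/imsetP[[u v]]]|->].
  by rewrite inE /= => uv -> xb yb; rewrite (blk_eq uv xy xb yb).
by rewrite mem_blocks // !inE !eqxx ?orbT.
Qed.

(** The colour type is arbitrary so that two-colourings can take values in [bool]. *)
Definition sq_coloring (C : Type) (f : V -> C) : Prop :=
  forall x y, x != y -> f x = f y -> f (t x y) <> f y.

Lemma coloring_blocksP k (f : {ffun V -> 'I_k}) :
  reflect (sq_coloring f) (coloring blocks f).
Proof.
apply: (iffP forall_inP) => [colf x y xy fxy fty|colf b].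
  move/negP: (colf _ (mem_blocks xy)); apply.
  apply/existsP; exists (f y); apply/forall_inP => z; rewrite !inE -orbA.
  by case/or3P => /eqP ->; apply/eqP.
case/imsetP => -[x y]; rewrite inE /= => xy ->.
apply/negP => /existsP[c /forall_inP mono].
have fc z : z \in blk x y -> f z = c by move=> /mono/eqP.
by apply: (colf x y xy); rewrite !fc // !inE eqxx ?orbT.
Qed.

(** * Absence of 2-colourings *)

Import GRing.Theory Num.Theory.

(* For signs a, b, c that are not all equal, ab + bc + ca = -1; summing over
   all ordered pairs gives 3 (sum of signs)^2 = 3 v - v (v - 1). *)
Lemma not_sq_2coloring (f : V -> bool) : 4 < #|V| -> ~ sq_coloring f.
Proof.
case: (tP) => tid tC tK V4 colf.
pose s x : int := (if f x then 1 else - 1)%R.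
pose P : int := (\sum_x \sum_y s x * s y)%R.
have PE : P = ((\sum_x s x) ^+ 2)%R.
  rewrite expr2 mulr_suml; apply: eq_bigr => x _.
  by rewrite mulr_sumr.
have reidx x (F : V -> int) : (\sum_y F (t x y) = \sum_y F y)%R.
  by rewrite [RHS](reindex_inj (can_inj (tK x))).
have P1 : P = (\sum_x \sum_y s x * s (t x y))%R.
  by apply: eq_bigr => x _; rewrite (reidx x (fun y => s x * s y)%R).
have P2 : P = (\sum_x \sum_y s y * s (t x y))%R.
  by rewrite P1 exchange_big; do 2 apply: eq_bigr => ? _; rewrite tC.
(* A diagonal pair contributes 3 = 4 - 1, any other pair -1. *)
have P3 : (P + P + P =
    \sum_(x : V) \sum_(y : V) (if x == y then 4 else 0) -
    \sum_(x : V) \sum_(y : V) 1)%R.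
  rewrite {1}P1 {1}P2 /P -!big_split /= -sumrB; apply: eq_bigr => x _.
  rewrite -!big_split /= -sumrB; apply: eq_bigr => y _.
  case: eqVneq => [<-|xy]; first by rewrite tid /s; case: (f x).
  move: (colf x y xy); rewrite /s.
  by case: (f x) (f y) (f (t x y)) => [] [] [] // /(_ erefl).
have := sqr_ge0 (\sum_x s x)%R; rewrite -PE.
move: P3.
under [X in (_ = X - _)%R]eq_bigr => x _.
  rewrite -big_mkcond (big_pred1 x); last by move=> y; rewrite /= eq_sym.
  over.
rewrite !sumr_const -[(4 *+ _)%R]mulr_natr -[(_ *+ _ *+ _)%R]mulr_natr !natz.
(* From five points on, 4N - N^2 <= -N < 0, which contradicts [P] being a square. *)
have V5 : 5 * #|V| <= #|V| * #|V| by rewrite leq_mul2r V4 orbT.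
move: P PE P1 P2 (#|V|) V4 V5 => p _ _ _ N; lia.
Qed.

(** With at most two colours, having colour 0 or not already determines the colour. *)
Lemma blocks_not_colorable j : j < 3 -> 4 < #|V| -> ~~ colorable j blocks.
Proof.
move=> j3 V4; apply/existsP => -[f /coloring_blocksP colf].
apply: (@not_sq_2coloring (fun x => f x == 0 :> nat)) => // x y xy.
have fE z w : (f z == 0 :> nat) = (f w == 0 :> nat) -> f z = f w.
  case: (f z) (f w) => [a aj] [b bj] /= ab; apply: val_inj => /=.
  move: (leq_trans aj j3) (leq_trans bj j3) ab.
  by case: a b {aj bj} => [|[|]] // [|[|]].
by move=> /fE fxy /fE; exact: colf.
Qed.

(** Outside [S], each wrong colour would complete a monochromatic block whose other two points lie
    in [S]. A point of [S] that can be recoloured alone belongs to every defining set. *)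
Lemma minimal_defining_set_blocks k (f : {ffun V -> 'I_k}) (S : {set V}) :
    sq_coloring f ->
    (forall x c, x \notin S -> c != f x ->
      exists2 y, y != x & [/\ y \in S, t x y \in S, f y = c & f (t x y) = c]) ->
    (forall x, x \in S -> exists2 c, c != f x &
      forall y, y != x -> f y = c -> f (t x y) <> c) ->
  minimal_defining_set blocks f S.
Proof.
case: (tP) => tid tC tK colf forced free; apply/andP; split.
  apply/andP; split; first exact/coloring_blocksP.
  apply/forallP => g; apply/implyP => /andP[/coloring_blocksP colg /forall_inP gf].
  apply/eqP/ffunP => x.
  have [/gf/eqP//|xS] := boolP (x \in S).
  apply/eqP/contraT => /(forced _ _ xS)[y yx [yS tS fy ft]].
  rewrite eq_sym in yx; case: (colg x y yx).
  - by rewrite -[LHS]fy (eqP (gf _ yS)).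
  - by rewrite (eqP (gf _ yS)) (eqP (gf _ tS)) fy ft.
apply/forallP => T; apply/implyP => /properP[_ [x xS xT]].
have [c cf xfree] := free x xS.
pose g := [ffun y => if y == x then c else f y].
apply/negP => /andP[_ /forallP/(_ g)]; apply/negP; rewrite negb_imply.
apply/andP; split; last first.
  by apply: contra cf => /eqP/ffunP/(_ x); rewrite ffunE eqxx => ->.
apply/andP; split; last first.
  apply/forall_inP => y yT; rewrite ffunE; case: (eqVneq y x) => // yx.
  by rewrite -yx yT in xT.
apply/coloring_blocksP => u v uv; rewrite !ffunE.
have tuv := sq_neql uv; have tvu := sq_neqr uv.
(* The recoloured point [x] may be [u], [v] or [t u v]; a block avoiding it keeps its colours under
   [f]. *)
case: (eqVneq u x) => [ux|ux].
  rewrite -ux [v == u]eq_sym (negbTE uv) (negbTE tuv) => cfv ft.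
  by apply: (xfree v); rewrite -?ux // 1?eq_sym // ft.
case: (eqVneq v x) => [vx|vx].
  rewrite -vx (negbTE tvu) => fuc ft.
  by apply: (xfree u); rewrite -?vx // tC.
case: (eqVneq (t u v) x) => [tx|_ fuv ftv].
  move=> fuv cfv; apply: (xfree v vx) => //.
  by rewrite -tx tC [t u v]tC tK fuv.
exact: (colf u v uv fuv).
Qed.

End Quasigroup.

Lemma steiner_quasigroup_can (V W : Type) (h : V -> W) (h' : W -> V)
    (t : W -> W -> W) : cancel h h' -> cancel h' h ->
  steiner_quasigroup t -> steiner_quasigroup (fun x y => h' (t (h x) (h y))).
Proof.
by move=> hK hK' [tid tC tK]; split=> [x|x y|x y] /=;
   rewrite ?tid ?hK' ?tK ?hK // tC.
Qed.

(** * The Skolem construction *)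

(** A commutative quasigroup with left division [ldiv]; [flip] pairs each idempotent with the other
    element whose square it is. *)
Definition half_idempotent (Q : Type) (op ldiv : Q -> Q -> Q) (low : pred Q)
    (flip : Q -> Q) : Prop :=
  [/\ commutative op,
      forall i j, op i (ldiv i j) = j /\ ldiv i (op i j) = j,
      forall i, op i i = if low i then i else flip i,
      forall i, low (flip i) = ~~ low i
    & involutive flip].

Section Skolem.
Variables (Q : finType) (op ldiv : Q -> Q -> Q) (low : pred Q) (flip : Q -> Q).
Hypothesis QP : half_idempotent op ldiv low flip.

Local Notation P := (option (Q * 'I_3)).

Definition nxt (k : 'I_3) : 'I_3 := inord (k.+1 %% 3).
Definition prv (k : 'I_3) : 'I_3 := inord (k.+2 %% 3).

(* The third point of the block through (i, k) and (j, k + 1); [None] is the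
   point at infinity. *)
Definition skolem_up i (k : 'I_3) j : P :=
  if ldiv i j != i then Some (ldiv i j, k)
  else if low i then Some (i, prv k) else None.

(** The blocks through infinity contain [(i, k)] and [(flip i, prv k)] with [i] low. *)
Definition skolem_inf i (k : 'I_3) : P :=
  Some (flip i, if low i then prv k else nxt k).

(** Besides the blocks through infinity there are the columns over a low [i], and
    [(i, k), (j, k), (op i j, nxt k)] for [i != j]. *)
Definition skolem (x y : P) : P :=
  match x, y with
  | None, None => None
  | None, Some (i, k) | Some (i, k), None => skolem_inf i k
  | Some (i, k), Some (j, l) =>
    if k == l then (if i == j then x else Some (op i j, nxt k))
    else if l == nxt k then skolem_up i k j else skolem_up j l i
  end.

Lemma nxt_prv k : nxt (prv k) = k.
Proof. by apply: val_inj; case: k => [[|[|[|]]] ?] //=; rewrite !inordK. Qed.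
Lemma prv_nxt k : prv (nxt k) = k.
Proof. by apply: val_inj; case: k => [[|[|[|]]] ?] //=; rewrite !inordK. Qed.
Lemma nxt_nxt k : nxt (nxt k) = prv k.
Proof. by apply: val_inj; case: k => [[|[|[|]]] ?] //=; rewrite !inordK. Qed.
Lemma prv_prv k : prv (prv k) = nxt k.
Proof. by rewrite -nxt_nxt nxt_prv. Qed.
Lemma nxt_neq k : (nxt k == k) = false.
Proof.
apply/negbTE; rewrite -val_eqE.
by case: k => [[|[|[|]]] ?] //=; rewrite !inordK.
Qed.
Lemma prv_neq k : (prv k == k) = false.
Proof. by rewrite -{2}[k]nxt_prv eq_sym nxt_neq. Qed.
Lemma nxt_neq_prv k : (nxt k == prv k) = false.
Proof. by rewrite -nxt_nxt eq_sym nxt_neq. Qed.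
Lemma neq_nxt k : (k == nxt k) = false.
Proof. by rewrite eq_sym nxt_neq. Qed.
Lemma neq_prv k : (k == prv k) = false.
Proof. by rewrite eq_sym prv_neq. Qed.
Lemma prv_neq_nxt k : (prv k == nxt k) = false.
Proof. by rewrite eq_sym nxt_neq_prv. Qed.

Definition lvlE := (nxt_prv, prv_nxt, nxt_nxt, prv_prv, nxt_neq, prv_neq,
  neq_nxt, neq_prv, nxt_neq_prv, prv_neq_nxt, eqxx).

Variant lvl_spec (k : 'I_3) : 'I_3 -> Type :=
| LvlEq : lvl_spec k k
| LvlNxt : lvl_spec k (nxt k)
| LvlPrv : lvl_spec k (prv k).

Lemma lvlP k l : lvl_spec k l.
Proof.
have [->|kl] := eqVneq l k; first exact: LvlEq.
have [->|nl] := eqVneq l (nxt k); first exact: LvlNxt.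
suff -> : l = prv k by exact: LvlPrv.
apply: val_inj; move: kl nl; rewrite -!val_eqE.
by case: k l => [[|[|[|?]]] ?] [[|[|[|?]]] ?] //=; rewrite !inordK.
Qed.

Lemma skolem_quasigroup : steiner_quasigroup skolem.
Proof.
case: QP => opC opdiv opid lowf flipK.
have opK i j : op i (ldiv i j) = j by case: (opdiv i j).
have ldivK i j : ldiv i (op i j) = j by case: (opdiv i j).
have ldivC i j : ldiv (ldiv i j) j = i by rewrite -{2}(opK i j) opC ldivK.
(* Here [j] is the square of [i], and the pair [(i, k), (j, nxt k)] falls to a column or to a block
   through infinity. *)
have ldiv_id i j : ldiv i j = i -> j = if low i then i else flip i.
  by move=> h; rewrite -(opK i j) h opid.
have skC x y : skolem x y = skolem y x.
  case: x y => [[i k]|] [[j l]|] //=.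
  by case: (lvlP k l); rewrite ?lvlE // opC [j == i]eq_sym; case: eqP => // ->.
split=> //.
  by case=> [[i k]|] //=; rewrite !eqxx.
have ldiv_low i : low i -> ldiv i i = i.
  by move=> li; have := ldivK i i; rewrite opid li.
have ldiv_high i : ~~ low i -> ldiv i (flip i) = i.
  by move=> li; have := ldivK i i; rewrite opid (negbTE li).
case=> [[i k]|] [[j l]|] //=.
- case: (lvlP k l); rewrite ?lvlE /skolem_up.
  + case: eqVneq => [->|ij]; first by rewrite /= !eqxx.
    by rewrite /= !lvlE /skolem_up ldivK eq_sym ij.
  + case: eqVneq => [h|h] /=; last by rewrite !lvlE eq_sym (negbTE h) opK.
    case: ifP => li; rewrite /= ?lvlE /skolem_up /skolem_inf.
      by rewrite ldiv_low // eqxx /= li (ldiv_id _ _ h) li.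
    by rewrite li (ldiv_id _ _ h) li.
  + case: eqVneq => [h|h] /=; last first.
      by rewrite !lvlE /skolem_up ldivC eq_sym h.
    have := ldiv_id _ _ h; case: ifP => lj ij;
      rewrite /= ?lvlE /skolem_up /skolem_inf.
      by rewrite ij ldiv_low // eqxx lj /= ?lvlE.
    by rewrite ij flipK lowf lj /= ?lvlE.
- case: (boolP (low i)) => li; rewrite /= !lvlE /skolem_up.
    have := ldiv_high (flip i); rewrite lowf flipK li => -> //.
    by rewrite eqxx.
  by rewrite ldiv_high // eqxx (negbTE li).
- by rewrite /skolem_inf lowf flipK; case: (low j); rewrite /= !lvlE.
Qed.

(** * The level colouring and its omitted points *)

Definition skolem_col (x : P) : 'I_3 := if x is Some (_, k) then k else nxt ord0.

Definition skolem_omitted (x : P) : bool :=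
  if x is Some (i, k) then (k == ord0) && ~~ low i else false.

(** Two points of one level have their third point on the next level, and a block through infinity
    meets two different levels. *)
Lemma skolem_coloring : sq_coloring skolem skolem_col.
Proof.
case=> [[i k]|] [[j l]|] //= xy.
- move=> kl; rewrite -kl eqxx in xy *.
  have /negbTE-> : i != j by apply: contraNneq xy => ->.
  by move/eqP; rewrite /= lvlE.
- by move=> -> /eqP; case: ifP; rewrite !lvlE.
- by move=> <- /eqP; case: ifP; rewrite !lvlE.
Qed.

Lemma skolem_forced x c : skolem_omitted x -> c != skolem_col x ->
  exists2 y, y != x & [/\ ~~ skolem_omitted y, ~~ skolem_omitted (skolem x y),
    skolem_col y = c & skolem_col (skolem x y) = c].
Proof.
case: QP => opC opdiv opid lowf flipK.
case: x => [[i k]|] //= /andP[/eqP-> li].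
(* Otherwise the high element [i] would be idempotent. *)
have di : ldiv i i != i.
  apply: contraNneq li => h; have [] := opdiv i i; rewrite h opid.
  by case: (boolP (low i)) => // {}li fi _; move: (lowf i); rewrite fi (negbTE li).
case: (lvlP ord0 c) => [|_|_]; first by rewrite eqxx.
- by exists None; rewrite //= (negbTE li) !lvlE.
(* The third point of this block is [(ldiv i i, prv ord0)], also on level 2. *)
exists (Some (i, prv ord0)); first by apply: contraFneq (prv_neq ord0) => -[->].
by rewrite /= !lvlE /skolem_up di /= !lvlE.
Qed.

(** A point [(i, k)] takes colour [nxt k]: a block joining it to level [nxt k] ends on level [k], on
    level [prv k] or at infinity. Infinity has colour [nxt k] only for [k = 0], and there a low [i]
    is joined through infinity to level 2. *)
Lemma skolem_recolor x : ~~ skolem_omitted x ->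
  exists2 c, c != skolem_col x &
    forall y, y != x -> skolem_col y = c -> skolem_col (skolem x y) <> c.
Proof.
case: x => [[i k]|] /=; last first.
  move=> _; exists ord0; rewrite ?lvlE // => -[[j l]|] //= _ ->.
  by case: (low j) => /eqP; rewrite lvlE.
case: (lvlP ord0 k) => /=.
- rewrite negbK => li; exists (nxt ord0); rewrite ?lvlE // => -[[j l]|] //= _.
    move=> ->; rewrite !lvlE /skolem_up li.
    by case: ifP => _ /eqP; rewrite /= !lvlE.
  by move=> _ /eqP; rewrite li lvlE.
- move=> _; exists (prv ord0); rewrite ?lvlE // => -[[j l]|] //= _.
    move=> ->; rewrite !lvlE /skolem_up.
    case: ifP => _; first by move/eqP; rewrite /= lvlE.
    by case: (low i) => /eqP; rewrite /= !lvlE.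
  by move=> /eqP; rewrite lvlE.
- move=> _; exists ord0; rewrite ?lvlE // => -[[j l]|] //= _.
    move=> ->; rewrite !lvlE /skolem_up.
    case: ifP => _; first by move/eqP; rewrite /= lvlE.
    by case: (low i) => /eqP; rewrite /= !lvlE.
  by move=> /eqP; rewrite lvlE.
Qed.

(** The involution [flip] exchanges the high and low halves of [Q]. *)
Lemma card_skolem_omitted : 2 * #|[pred x | skolem_omitted x]| = #|Q|.
Proof.
case: QP => _ _ _ lowf flipK.
pose H := [set i | ~~ low i].
have -> : #|[pred x | skolem_omitted x]| = #|H|.
  rewrite -(card_imset (f := fun i => Some (i, ord0) : P)); last by move=> i j [].
  apply: eq_card => x; rewrite !inE; apply/idP/imsetP.
    by case: x => [[i k]|] //= /andP[/eqP-> li]; exists i; rewrite ?inE.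
  by case=> i; rewrite inE => li ->.
rewrite mul2n -addnn -(cardsC H); congr addn.
rewrite -(card_imset H (can_inj flipK)); apply: eq_card => i; rewrite !inE negbK.
apply/imsetP/idP => [[j]|li]; first by rewrite inE => lj ->; rewrite lowf.
by exists (flip i); rewrite ?flipK // inE lowf li.
Qed.

End Skolem.

Lemma skolem_system (Q : finType) (op ldiv : Q -> Q -> Q) (low : pred Q)
    (flip : Q -> Q) m k :
    half_idempotent op ldiv low flip -> #|{: option (Q * 'I_3)}| = m -> 4 < m ->
    #|Q| = 2 * k ->
  exists M : {set {set 'I_m}},
    [/\ steiner_triple_system M, chromatic 3 M & m - k <= max_mds M 3].
Proof.
move=> QP <- m4 Qk; set T := option (Q * 'I_3) in m4 *.
pose t (x y : 'I_#|{: T}|) :=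
  enum_rank (skolem op ldiv low flip (enum_val x) (enum_val y)).
have tP : steiner_quasigroup t.
  apply: (steiner_quasigroup_can (h := @enum_val T predT));
    last exact: skolem_quasigroup.
  - exact: enum_valK.
  - exact: enum_rankK.
have val_neq (x y : 'I_#|{: T}|) : x != y -> enum_val x != enum_val y :> T.
  by apply: contra => /eqP/enum_val_inj->.
pose f : {ffun 'I_#|{: T}| -> 'I_3} := [ffun x => skolem_col (enum_val x : T)].
pose S := [set x : 'I_#|{: T}| | ~~ skolem_omitted low (enum_val x : T)].
have colf : sq_coloring t f.
  move=> x y /val_neq xy; rewrite !ffunE enum_rankK.
  exact: skolem_coloring xy.
have mdsf : minimal_defining_set (blocks t) f S.
  apply: (minimal_defining_set_blocks tP colf) => x.
    move=> c; rewrite inE negbK ffunE => /(skolem_forced QP) omx /omx[y yx H].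
    exists (enum_rank y); first by apply: contra yx => /eqP <-; rewrite enum_rankK.
    by rewrite /t !inE !ffunE !enum_rankK.
  rewrite inE => /(skolem_recolor op ldiv flip)[c cx H].
  exists c; first by rewrite ffunE.
  by move=> y /val_neq yx; rewrite !ffunE enum_rankK; exact: H.
exists (blocks t); split.
- exact: steiner_blocks.
- apply/andP; split; first by apply/existsP; exists f; exact/coloring_blocksP.
  by apply/forallP => j; apply: blocks_not_colorable; rewrite // ?card_ord // -ltnS.
apply: (@leq_trans #|S|); last first.
  rewrite /max_mds (bigD1 f) //= (bigD1 S) //= -maxnA; exact: leq_maxl.
(* It remains to bound the complement of [S], which embeds into the omitted points, by [k]. *)
rewrite leq_subLR -[X in X <= _](card_ord) -(cardsC S) addnC leq_add2r.
rewrite -(leq_pmul2l (isT : 0 < 2)) -Qk -(card_skolem_omitted QP) leq_pmul2l //.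
rewrite -(card_imset _ (@enum_val_inj T predT)); apply/subset_leq_card/subsetP => x.
by case/imsetP => y; rewrite !inE negbK => oy ->.
Qed.

(** * A half-idempotent quasigroup of order [2 * n] *)

Section HalfIdempotentOrd.
Variable n : nat.
Local Notation Q := 'I_(2 * n).

(* Skolem's quasigroup: addition modulo 2n followed by the relabelling 2r |-> r, 2r+1 |-> n+r. *)
Definition ho_op (i j : nat) : nat :=
  let s := if i + j < 2 * n then i + j else i + j - 2 * n in
  if odd s then n + s./2 else s./2.

(** [s] undoes the relabelling of [j]; then [i] is subtracted modulo [2 * n]. *)
Definition ho_ldiv (i j : nat) : nat :=
  let s := if j < n then 2 * j else 2 * (j - n) + 1 in
  if i <= s then s - i else s + 2 * n - i.

Definition ho_flip (i : nat) : nat := if i < n then i + n else i - n.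

Lemma ho_op_lt (i j : Q) : ho_op i j < 2 * n.
Proof. by rewrite /ho_op; move: (ltn_ord i) (ltn_ord j); do 2 case: ifP; lia. Qed.

Lemma ho_ldiv_lt (i j : Q) : ho_ldiv i j < 2 * n.
Proof. by rewrite /ho_ldiv; move: (ltn_ord i) (ltn_ord j); do 2 case: ifP; lia. Qed.

Lemma ho_flip_lt (i : Q) : ho_flip i < 2 * n.
Proof. by rewrite /ho_flip; move: (ltn_ord i); case: ifP; lia. Qed.

(** On the diagonal the reduced sum is even, and its half is [i] if [i < n], else [i - n]. *)
Lemma half_idempotent_ord :
  half_idempotent (fun i j : Q => Ordinal (ho_op_lt i j))
    (fun i j : Q => Ordinal (ho_ldiv_lt i j)) (fun i : Q => i < n)
    (fun i : Q => Ordinal (ho_flip_lt i)).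
Proof.
split.
- by move=> i j; apply: val_inj; rewrite /= /ho_op addnC.
- move=> i j; split; apply: val_inj => /=; rewrite /ho_op /ho_ldiv /=;
  move: (ltn_ord i) (ltn_ord j); repeat case: ifP; lia.
- move=> i; apply: val_inj; move: (ltn_ord i); rewrite fun_if /= /ho_op /ho_flip.
  repeat case: ifP; lia.
- move=> i /=; move: (ltn_ord i); rewrite /ho_flip; case: ifP; lia.
- move=> i; apply: val_inj; move: (ltn_ord i); rewrite /= /ho_flip.
  repeat case: ifP; lia.
Qed.

End HalfIdempotentOrd.

Theorem theorem3p4 (n : nat) (hn : 1 <= n) :
  (exists M : {set {set 'I_(6 * n + 1)}},
     [/\ steiner_triple_system M, colorable 3 M & 5 * n + 1 <= max_mds M 3])
  /\ 5 * n + 1 <= max_mds_order (6 * n + 1) 3.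
Proof.
have [|||M [Ms Mc Mn]] :=
  skolem_system (half_idempotent_ord n) (m := 6 * n + 1) (k := n).
- by rewrite card_option card_prod !card_ord; lia.
- by lia.
- by rewrite card_ord.
have {}Mn : 5 * n + 1 <= max_mds M 3 by apply: leq_trans Mn; lia.
split; first by exists M; split=> //; case/andP: Mc.
apply: leq_trans Mn _; rewrite /max_mds_order (bigD1 M) ?Ms //=; exact: leq_maxl.
Qed.
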